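(* Let $\lambda$ be a partition and $p$ a positive integer. For every integer $r\ge 0$, \[\sum_{k=1}^{l(\lambda)} d_\lambda(k,p)\,(\lambda_k-k)^r=(-1)^r\sum_{i,j\ge 0}(-1)^j\binom{r}{j}\,s(p+1,i-j)\,c^\lambda_i(p).\]
   Context: For $1\le k\le l(\lambda)$, \[d_\lambda(k,p)=(\lambda_k+l(\lambda)-k)_p\prod_{i=1,\,i\neq k}^{l(\lambda)}\frac{\lambda_k-\lambda_i+i-k-p}{\lambda_k-\lambda_i+i-k},\] where $(z)_p=z(z-1)\cdots(z-p+1)$ is the lowering factorial. The Stirling numbers of the first kind are defined by $(z)_m=\sum_t s(m,t)z^t$, with $s(m,t)=0$ unless $1\le t\le m$ (in particular $s(m,t)=0$ for $t\le 0$). For a finite integer sequence $\lambda=(\lambda_1,\ldots,\lambda_l)$ (for a partition, $l=l(\lambda)$) and an indeterminate $x$, the quantities $c^\lambda_r(x)$, $r\ge0$, are defined by the expansion in descending powers of $y$ \[\prod_{i=1}^{l}\frac{(x-y+1+\lambda_i-i)(-y+1-i)}{(x-y+1-i)(-y+1+\lambda_i-i)}=-x\sum_{r\ge 0}c^\lambda_r(x)\,y^{-r};\] for a partition the left side equals $\frac{C_\lambda(x-y+1)}{C_\lambda(x-y)}\frac{C_\lambda(-y)}{C_\lambda(-y+1)}$ with $C_\lambda(z)=\prod_{(i,j)\in\lambda}(z+j-i)$ the content polynomial. *)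

(* Defs.v *)
(* The classical library serves only for finitely supported sums over an infinite
   index set. *)
From mathcomp Require Import all_boot all_order all_algebra.
From mathcomp Require Import boolp classical_sets fsbigop.

Set Implicit Arguments.
Unset Strict Implicit.
Unset Printing Implicit Defensive.

Import Order.TTheory GRing.Theory Num.Theory.
Local Open Scope ring_scope.

Definition is_partition (la : seq int) : bool :=
  sorted (fun m n : int => n <= m) la && all (fun m : int => 0 < m) la.

(* Parts are numbered from 1; [part la 0] is never used. *)
Definition part (la : seq int) (i : nat) : int := la`_i.-1.

Definition lowering (R : pzRingType) (z : R) (m : nat) : R :=
  \prod_(0 <= i < m) (z - i%:R).

Definition dcoef (la : seq int) (k p : nat) : rat :=
  let l := size la in
  lowering ((part la k)%:~R + l%:R - k%:R) p *
  \prod_(1 <= i < l.+1 | i != k)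
    (((part la k)%:~R - (part la i)%:~R + i%:R - k%:R - p%:R) /
     ((part la k)%:~R - (part la i)%:~R + i%:R - k%:R)).

(* The coefficient of 'X^t in the polynomial ('X)_m. *)
Definition stirling1 (m : nat) (t : int) : int :=
  match t with
  | Posz n => (lowering ('X : {poly int}) m)`_n
  | Negz _ => 0
  end.

Lemma size_lowering (m : nat) : size (lowering ('X : {poly int}) m) = m.+1.
Proof.
rewrite /lowering; under eq_bigr do rewrite -polyC_natr.
by rewrite size_prod_XsubC size_iota subn0.
Qed.

Lemma stirling1_eq0 (m : nat) (t : int) :
  (0 < m)%N -> ~~ (1 <= t <= m%:Z) -> stirling1 m t = 0.
Proof.
case: t => [[|n]|n] //= m_gt0.
  by move=> _; rewrite -horner_coef0 /lowering big_ltn // hornerM !hornerE.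
by rewrite lez_nat -ltnNge => lt_mn; rewrite nth_default // size_lowering.
Qed.

(* Sums over all pairs (i, j) against these weights are finitely supported, so
   the finitely supported sum operator gives them their actual value. *)
Lemma stirling1_support (m r i j : nat) : (0 < m)%N ->
  'C(r, j)%:R * (stirling1 m (i%:Z - j%:Z))%:~R != 0 :> rat ->
  (j <= r)%N /\ (i <= r + m)%N.
Proof.
move=> m0; have [le_jr|/bin_small->] := leqP j r; last by rewrite mul0r eqxx.
have [/andP[_]|/(stirling1_eq0 m0)->] := boolP (1 <= i%:Z - j%:Z <= m%:Z).
  rewrite lerBlDr -PoszD lez_nat => le_i _; split=> //.
  by rewrite (leq_trans le_i) // addnC leq_add2r.
by rewrite mulr0 eqxx.
Qed.

(* P / Q = \sum_(r >= 0) a r * y^-r : truncating the series at r = N leaves a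
   remainder P / Q - \sum_(r <= N) a r * y^-r of degree < - N in y, here
   multiplied through by y^N * Q. *)
Definition desc_expansion (K : fieldType) (P Q : {poly K}) (a : nat -> K) :=
  forall N : nat,
    (size (('X^N * P - Q * \sum_(r < N.+1) a r *: 'X^(N - r))%R) < size Q)%N.

(* The polynomial part of y^r * P / Q has as constant coefficient the
   coefficient of y^-r in the expansion of P / Q in descending powers of y. *)
Definition desc_coef (K : fieldType) (P Q : {poly K}) (r : nat) : K :=
  (('X^r * P) %/ Q)`_0.

Lemma desc_coef_expansion (K : fieldType) (P Q : {poly K}) :
  Q != 0 -> (size P <= size Q)%N -> desc_expansion P Q (desc_coef P Q).
Proof.
move=> Q0 sPQ N.
suff <- : ('X^N * P) %/ Q = \sum_(r < N.+1) desc_coef P Q r *: 'X^(N - r).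
  by rewrite {1}(divp_eq ('X^N * P) Q) mulrC addrC addKr ltn_modp.
have coefq m n : (('X^(m + n) * P) %/ Q)`_m = (('X^n * P) %/ Q)`_0.
  rewrite exprD -mulrA {1}(divp_eq ('X^n * P) Q) mulrDr mulrA.
  rewrite divpD mulpK // coefD coefXnM ltnn subnn.
  rewrite [X in _ + X]nth_default ?addr0 // size_divp //.
  have [->|R0] := eqVneq (('X^n * P) %% Q) 0; first by rewrite mulr0 size_poly0.
  rewrite size_monicM ?monicXn // size_polyXn addSn /=.
  by rewrite leq_subLR addnC leq_add2r -ltnS prednK ?ltn_modp ?size_poly_gt0.
have szq : (size (('X^N * P) %/ Q)%R <= N.+1)%N.
  rewrite size_divp // leq_subLR.
  have [->|P0] := eqVneq P 0; first by rewrite mulr0 size_poly0.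
  rewrite size_monicM ?monicXn // size_polyXn addSn /= addnS -addSn.
  rewrite (leq_trans (leq_add (leqnn N) sPQ)) // addnC.
  by rewrite leq_add2r leqSpred.
rewrite (reindex_inj rev_ord_inj) /=; apply/polyP => m; rewrite coef_sum.
have [le_mN|lt_Nm] := leqP m N; last first.
  rewrite nth_default; last exact: leq_trans szq lt_Nm.
  rewrite big1 // => i _; rewrite coefZ coefXn subSS subKn ?leq_ord //.
  by rewrite gtn_eqF ?mulr0 // (leq_ltn_trans (leq_ord i)).
rewrite (bigD1 (Ordinal (le_mN : (m < N.+1)%N))) //= big1 ?addr0.
  by rewrite coefZ coefXn subSS subKn // eqxx mulr1 -{1}(subnKC le_mN) coefq.
move=> i neq; rewrite coefZ coefXn subSS subKn ?leq_ord //.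
by rewrite eq_sym -[m]/(val (Ordinal (le_mN : (m < N.+1)%N))) val_eqE
  (negPf neq) mulr0.
Qed.

Lemma desc_expansion_unique (K : fieldType) (P Q : {poly K}) (a b : nat -> K) :
  desc_expansion P Q a -> desc_expansion P Q b -> a =1 b.
Proof.
move=> ea eb N; set S := fun c : nat -> K => \sum_(r < N.+1) c r *: 'X^(N - r).
have coefS c : (S c)`_0 = c N.
  rewrite /S coef_sum big_ord_recr /= subnn coefZ coefXn eqxx mulr1 big1 ?add0r//.
  by move=> i _; rewrite coefZ coefXn eq_sym subn_eq0 leqNgt ltn_ord mulr0.
rewrite -(coefS a) -(coefS b); suff -> : S a = S b by [].
apply/eqP; rewrite -subr_eq0; apply/negPn/negP => nz.
have Q0 : Q != 0 by rewrite -size_poly_gt0; exact: leq_ltn_trans (ea 0%N).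
have lt_Q : (size (Q * (S a - S b))%R < size Q)%N.
  have -> : Q * (S a - S b) =
      ('X^N * P - Q * S b) + - ('X^N * P - Q * S a).
    by rewrite opprB [RHS]addrC addrA subrK mulrBr.
  apply: leq_ltn_trans (size_polyD _ _) _.
  by rewrite size_polyN gtn_max ea eb.
suff : (size Q <= size (Q * (S a - S b))%R)%N by rewrite leqNgt lt_Q.
by rewrite size_mul // -(prednK (_ : (0 < size (S a - S b)%R)%N))
  ?size_poly_gt0 // addnS leq_addr.
Qed.

Lemma ratfunE (R : idomainType) (f : {fraction R}) :
  let r := generic_quotient.repr f in
  f * FracField.tofrac \d_r = FracField.tofrac \n_r.
Proof.
move=> r; rewrite -[f in LHS]generic_quotient.reprK -/r; unlock FracField.tofrac.
rewrite -[LHS]FracField.pi_mul; apply/generic_quotient.eqmodP => /=.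
rewrite FracField.equivfE /FracField.mulf !numden_Ratio ?mulr1 ?oner_eq0 ?denom_ratioP //.
by rewrite mulrC.
Qed.

(* Value at [a] of a rational function, computed on its reduced fraction:
   a representative chosen by the quotient need not be in lowest terms. *)
Definition ratfun_eval (F : fieldType) (f : {fraction {poly F}}) (a : F) : F :=
  let n := \n_(generic_quotient.repr f) in
  let d := \d_(generic_quotient.repr f) in
  (n %/ gcdp n d).[a] / (d %/ gcdp n d).[a].

Lemma ratfun_evalE (F : fieldType) (n d : {poly F}) (a : F) : d.[a] != 0 ->
  ratfun_eval (FracField.tofrac n / FracField.tofrac d) a = n.[a] / d.[a].
Proof.
move=> da0; set f := _ / _; rewrite /ratfun_eval.
set n' := \n_ _; set d' := \d_ _; set g := gcdp n' d'.
have d'0 : d' != 0 by exact: denom_ratioP.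
have d0 : d != 0 by apply: contraNneq da0 => ->; rewrite horner0.
have g0 : g != 0 by rewrite gcdp_eq0 negb_and d'0 orbT.
have ef : f = FracField.tofrac n' / FracField.tofrac d'.
  apply: (canRL (mulfK _)); first by rewrite tofrac_eq0.
  exact: ratfunE.
have e1 : n * (d' %/ g) = (n' %/ g) * d.
  apply: (mulIf g0); rewrite -mulrA divpK ?dvdp_gcdr //.
  rewrite mulrAC divpK ?dvdp_gcdl //; apply/eqP; rewrite -tofrac_eq !tofracM.
  move/eqP: ef; rewrite /f GRing.eqr_div ?tofrac_eq0 //.
have cop : coprimep (d' %/ g) (n' %/ g).
  by rewrite coprimep_sym coprimep_div_gcd // d'0 orbT.
have /dvdpP[e de] : d' %/ g %| d.
  by rewrite -(Gauss_dvdpr _ cop) -e1 dvdp_mull.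
have d1a : (d' %/ g).[a] != 0.
  by apply: contraNneq da0 => d1a; rewrite de hornerM d1a mulr0.
by apply/eqP; rewrite GRing.eqr_div // -!hornerM e1.
Qed.

Lemma linear_polyE (R : nzRingType) (c : R) (m : int) (n : nat) :
  c%:P - 'X + 1 + m%:~R - n%:R = (c + 1 + m%:~R - n%:R)%:P - 'X.
Proof.
rewrite polyCB !polyCD polyC1 polyC_natr (rmorph_int (@polyC R)).
by rewrite -!addrA; congr (_ + _); rewrite addrC -!addrA.
Qed.

Lemma size_linear_prod (K : fieldType) (x z : K) (a b : nat -> int) (l : nat) :
  size (\prod_(1 <= i < l.+1)
    ((x%:P - 'X + 1 + (a i)%:~R - i%:R) *
     (z%:P - 'X + 1 + (b i)%:~R - i%:R))) = l.*2.+1.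
Proof.
have szB (c : K) : size (c%:P - 'X) = 2 by rewrite -size_polyN opprB size_XsubC.
have B0 (c : K) : c%:P - 'X != 0 by rewrite -size_poly_gt0 szB.
rewrite big_add1 /=; elim: l => [|l IH]; first by rewrite big_geq // size_poly1.
rewrite big_nat_recr //= size_mul; first last.
- by rewrite !linear_polyE mulf_neq0.
- by rewrite -size_poly_gt0 IH.
by rewrite IH !linear_polyE size_mul // !szB !addnS addn0 doubleS.
Qed.

Section ContentRatio.
Variables (K : fieldType) (x : K) (la : seq int).

(* Numerator and denominator of the product, as polynomials in y = 'X. *)
Definition cnum : {poly K} :=
  \prod_(1 <= i < (size la).+1)
    ((x%:P - 'X + 1 + (part la i)%:~R - i%:R) * (- 'X + 1 - i%:R)).

Definition cden : {poly K} :=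
  \prod_(1 <= i < (size la).+1)
    ((x%:P - 'X + 1 - i%:R) * (- 'X + 1 + (part la i)%:~R - i%:R)).

Lemma size_cnum : size cnum = (size la).*2.+1.
Proof.
rewrite -(size_linear_prod x 0 (part la) (fun=> 0)).
by under [in RHS]eq_bigr do rewrite polyC0 sub0r addr0.
Qed.

Lemma size_cden : size cden = (size la).*2.+1.
Proof.
rewrite -(size_linear_prod x 0 (fun=> 0) (part la)).
by under [in RHS]eq_bigr do rewrite polyC0 sub0r addr0.
Qed.

Lemma cratio_expansion : desc_expansion cnum cden (desc_coef cnum cden).
Proof.
apply: desc_coef_expansion; last by rewrite size_cnum size_cden.
by rewrite -size_poly_gt0 size_cden.
Qed.

End ContentRatio.

(* The indeterminate x, as an element of the field of rational functions. *)
Definition ratX : {fraction {poly rat}} := FracField.tofrac 'X.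

Definition ccoef (la : seq int) (r : nat) : {fraction {poly rat}} :=
  - ratX^-1 * desc_coef (cnum ratX la) (cden ratX la) r.

Lemma ccoef_expansion (la : seq int) :
  desc_expansion (cnum ratX la) (cden ratX la) (fun r => - ratX * ccoef la r).
Proof.
have x0 : ratX != 0 by rewrite tofrac_eq0 polyX_eq0.
have -> : (fun r => - ratX * ccoef la r) =
          desc_coef (cnum ratX la) (cden ratX la).
  by apply/funext => r; rewrite /ccoef mulrA mulrNN divff // mul1r.
exact: cratio_expansion.
Qed.

(* Main.v *)
(* Write S(y) = (y)_(p+1) and let G(y) be the product defining the c_i at x = p.
   The coefficients of S(y) (1 - y)^r are the inner sums over j on the right, so
   the right side is, up to the factor -1/p, the constant coefficient of the
   expansion of S(y) (y - 1)^r G(y) in descending powers of y. The factors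
   p - y + 1 - i in the denominator of G cancel against S and the factors
   -y + 1 - i in the numerator, which leaves y (y + l - 1)_p; the
   remaining poles y = 1 + la_k - k are simple, and the residue there is
   -p d(k, p) (la_k - k)^r. *)
Require Import Defs.
From mathcomp Require Import all_boot all_order all_algebra.
From mathcomp Require Import boolp classical_sets fsbigop.
From mathcomp Require Import ring lra.

Set Implicit Arguments.
Unset Strict Implicit.
Unset Printing Implicit Defensive.

Import Order.TTheory GRing.Theory Num.Theory.
Local Open Scope ring_scope.

(* Sum of the residues of N / \prod_i ('X - a i), read off at infinity. *)
Lemma coef0_divp_XM (F : fieldType) (I : eqType) (s : seq I) (a : I -> F)
    (N : {poly F}) :
  uniq s -> {in s &, injective a} ->
  (('X * N) %/ \prod_(i <- s) ('X - (a i)%:P))`_0 =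
  \sum_(k <- s) N.[a k] / \prod_(i <- s | i != k) (a k - a i).
Proof.
move=> us ia; set V := \prod_(i <- s) _.
pose Vk k := \prod_(i <- s | i != k) ('X - (a i)%:P).
have VE k : k \in s -> V = ('X - (a k)%:P) * Vk k by move=> ks; rewrite /V (bigD1_seq k).
have Vkk k : (Vk k).[a k] = \prod_(i <- s | i != k) (a k - a i).
  by rewrite horner_prod; apply: eq_bigr => i _; rewrite hornerXsubC.
have Vk0 k : k \in s -> (Vk k).[a k] != 0.
  move=> ks; rewrite Vkk big_seq_cond prodf_seq_neq0; apply/allP => i is_ /=.
  rewrite is_ /=; apply/implyP => ik; rewrite subr_eq0.
  by apply: contraNneq ik => /ia ->.
pose c k := N.[a k] / (Vk k).[a k].
(* Lagrange interpolation: the sum of the [c k *: Vk k] agrees with [N] at each of the distinct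
   nodes [a k]. *)
have /dvdpP[q Eq] : V %| N - \sum_(k <- s) c k *: Vk k.
  rewrite /V -(big_map a predT (fun z => 'X - z%:P)); apply: uniq_roots_dvdp.
    rewrite all_map; apply/allP => j js /=; apply/rootP.
    rewrite hornerD hornerN horner_sum (bigD1_seq j) //= hornerZ divfK ?Vk0 //.
    rewrite big1 ?addr0 ?subrr // => k kj; rewrite hornerZ /Vk horner_prod.
    apply/eqP; rewrite mulf_eq0 prodf_seq_eq0; apply/orP; right.
    by apply/hasP; exists j; rewrite // eq_sym kj hornerXsubC subrr eqxx.
  by rewrite uniq_rootsE map_inj_in_uniq.
have szV : size V = (size s).+1 by rewrite /V size_prod_XsubC.
have szVk k : k \in s -> (size (Vk k) < size V)%N.
  move=> ks; rewrite (VE k ks) size_monicM ?monicXsubC ?size_XsubC //.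
  by apply: contraTneq (Vk0 k ks) => ->; rewrite horner0 eqxx.
(* Since ['X * Vk k = V + a k *: Vk k], the term [c k *: Vk k] contributes [c k] to the quotient and
   [(c k * a k) *: Vk k] to the remainder, while ['X * q] has no constant term. *)
have <- : 'X * q + (\sum_(k <- s) c k)%:P = ('X * N) %/ V.
  apply: (@divpP _ _ _ _ (\sum_(k <- s) (c k * a k) *: Vk k)).
    rewrite -[N](subrK (\sum_(k <- s) c k *: Vk k)) Eq mulrDr mulrDl mulrA.
    rewrite -addrA; congr (_ + _).
    rewrite (rmorph_sum (@polyC F)) /= mulr_suml mulr_sumr -big_split /=.
    apply: eq_big_seq => k ks; rewrite (VE k ks) -!mul_polyC polyCM; ring.
  rewrite big_seq; apply: (big_ind (fun u : {poly F} => (size u < size V)%N)).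
  - by rewrite size_poly0 szV.
  - by move=> u v su sv; rewrite (leq_ltn_trans (size_polyD _ _)) // gtn_max su.
  by move=> k ks; rewrite (leq_ltn_trans (size_scale_leq _ _)) ?szVk.
rewrite coefD coefXM coefC /= add0r; apply: eq_bigr => k _.
by rewrite /c Vkk.
Qed.

(** Division by [Q] is linear in the numerator, so [H] can be split into monomials. *)
Lemma coef0_divp_desc (K : fieldType) (P Q H : {poly K}) (n : nat) :
  (size H <= n)%N ->
  ((H * P) %/ Q)`_0 = \sum_(i < n) H`_i * desc_coef P Q i.
Proof.
move=> sH.
have -> : H = \sum_(i < n) H`_i *: 'X^i.
  by rewrite -poly_def -[LHS]coefK; apply/polyP => i; rewrite !coef_poly;
    case: ltnP => [/leq_trans->//|/(nth_default 0)->]; rewrite if_same.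
rewrite mulr_suml.
have divp_sum (f : 'I_n -> {poly K}) : (\sum_i f i) %/ Q = \sum_i (f i %/ Q).
  by apply: (big_morph (fun u => u %/ Q)) => [u v|]; rewrite ?divpD ?div0p.
rewrite divp_sum coef_sum; apply: eq_bigr => i _.
rewrite -poly_def coef_poly ltn_ord -scalerAl divpZl coefZ.
by rewrite /desc_coef.
Qed.

(** A monic divisor keeps its degree under any morphism [f], injective or not, so the image of a
    division with remainder is again one, and quotients are unique. This serves both the embedding
    into fractions and evaluation at a number. *)
Lemma desc_coef_map (R : idomainType) (K : fieldType) (f : {rmorphism R -> K})
    (P Q : {poly R}) (r : nat) :
  Q \is monic ->
  desc_coef (map_poly f P) (map_poly f Q) r = f ((('X^r * P) %/ Q)`_0).
Proof.
move=> mQ; rewrite -coef_map /desc_coef; congr ((polyseq _)`_0); apply/esym.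
refine (@divpP K _ _ _ (map_poly f (('X^r * P) %% Q)) _ _).
  rewrite -(map_polyXn f) -!rmorphM -rmorphD /=.
  by rewrite -(Pdiv.IdomainMonic.divp_eq mQ).
rewrite (size_map_poly_id0 (p := Q)); last first.
  by rewrite (monicP mQ) rmorph1 oner_eq0.
rewrite (leq_ltn_trans (size_poly _ _)) // ltn_modp monic_neq0 //.
Qed.

Section ContentRoots.
Variable la : seq int.
Let l := size la.

(* [cnum] and [cden] as products of monic linear factors, over a ring rather than
   a field so that both x = 'X and its values arise from {poly rat} by a morphism. *)
Definition content_num (R : comNzRingType) (x : R) : {poly R} :=
  \prod_(1 <= i < l.+1)
    (('X - (x + 1 + (part la i)%:~R - i%:R)%:P) * ('X - (1 - i%:R)%:P)).

Definition content_den (R : comNzRingType) (x : R) : {poly R} :=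
  \prod_(1 <= i < l.+1)
    (('X - (x + 1 - i%:R)%:P) * ('X - (1 + (part la i)%:~R - i%:R)%:P)).

Lemma cnumE (K : fieldType) (x : K) : cnum x la = content_num x.
Proof.
apply: eq_bigr => i _; rewrite !polyCB !polyCD !polyC1 polyC_natr.
by rewrite (rmorph_int (@polyC K)); ring.
Qed.

Lemma cdenE (K : fieldType) (x : K) : cden x la = content_den x.
Proof.
apply: eq_bigr => i _; rewrite !polyCB !polyCD !polyC1 polyC_natr.
by rewrite (rmorph_int (@polyC K)); ring.
Qed.

Lemma map_content_num (R S : comNzRingType) (f : {rmorphism R -> S}) (x : R) :
  map_poly f (content_num x) = content_num (f x).
Proof.
rewrite rmorph_prod; apply: eq_bigr => i _; rewrite rmorphM /= !map_polyXsubC /=.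
by rewrite !(rmorphB f) !(rmorphD f) (rmorph1 f) !(rmorph_nat f) (rmorph_int f).
Qed.

Lemma map_content_den (R S : comNzRingType) (f : {rmorphism R -> S}) (x : R) :
  map_poly f (content_den x) = content_den (f x).
Proof.
rewrite rmorph_prod; apply: eq_bigr => i _; rewrite rmorphM /= !map_polyXsubC /=.
by rewrite !(rmorphB f) !(rmorphD f) (rmorph1 f) !(rmorph_nat f) (rmorph_int f).
Qed.

Lemma monic_content_den (R : comNzRingType) (x : R) : content_den x \is monic.
Proof. by apply: monic_prod => i _; rewrite monicMl monicXsubC. Qed.

(** The denominator is monic in y over the polynomials in x, so the expansion coefficients are
    polynomials in x. The only denominator of [ccoef] is thus x itself, and specialising x commutes
    with the expansion. *)
Lemma ratfun_eval_ccoef (x : rat) (r : nat) : x != 0 ->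
  ratfun_eval (ccoef la r) x = - desc_coef (cnum x la) (cden x la) r / x.
Proof.
move=> x0; rewrite /ccoef !cnumE !cdenE /ratX.
rewrite -(map_content_num (FracField.tofrac (R := {poly rat}))).
rewrite -(map_content_den (FracField.tofrac (R := {poly rat}))).
rewrite desc_coef_map ?monic_content_den //.
set q := _`_0; rewrite mulNr mulrC -mulNr -tofracN ratfun_evalE ?hornerX //.
rewrite hornerN; congr (- _ / _).
have -> : content_num x = map_poly (horner_eval x) (content_num 'X).
  by rewrite map_content_num /= /horner_eval hornerX.
have -> : content_den x = map_poly (horner_eval x) (content_den 'X).
  by rewrite map_content_den /= /horner_eval hornerX.
by rewrite desc_coef_map ?monic_content_den.
Qed.

End ContentRoots.

(** Both sides are $(z+1)_{m+1}$, with its last factor split off on the left and its first on the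
    right. *)
Lemma loweringS (R : comPzRingType) (z : R) (m : nat) :
  lowering (z + 1) m * (z + 1 - m%:R) = (z + 1) * lowering z m.
Proof.
rewrite /lowering -big_nat_recr //= big_nat_recl //= subr0; congr (_ * _).
by apply: eq_bigr => i _; rewrite -natr1; ring.
Qed.

(** Induction on [l]: the step multiplies by $y+l$ on the left and by $y+l-p$ on the right, which is
    [loweringS] at $z=y+l-1$. *)
Lemma loweringX_shift (R : comNzRingType) (p l : nat) :
  lowering ('X : {poly R}) p.+1 * \prod_(1 <= i < l.+1) ('X - (1 - i%:R)%:P) =
  'X * lowering ('X + l%:R - 1) p *
    \prod_(1 <= i < l.+1) ('X - (p%:R + 1 - i%:R)%:P).
Proof.
elim: l => [|l IH].
  rewrite !big_geq // !mulr1 addr0 /lowering big_nat_recl //= subr0.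
  by congr (_ * _); apply: eq_bigr => i _; rewrite -natr1; ring.
rewrite big_nat_recr //= mulrA IH [in RHS]big_nat_recr //=.
have := loweringS ('X + l%:R - 1 : {poly R}) p.
rewrite subrK => E.
have -> : 'X + l.+1%:R - 1 = 'X + l%:R :> {poly R} by rewrite -natr1; ring.
have -> : l.+1%:R = l%:R + 1 :> R by rewrite natr1.
have -> : 'X - (1 - (l%:R + 1))%:P = 'X + l%:R :> {poly R}.
  by rewrite !polyCB !polyCD !polyC1 !polyC_natr; ring.
have -> : 'X - (p%:R + 1 - (l%:R + 1))%:P = 'X + l%:R - p%:R :> {poly R}.
  by rewrite !polyCB !polyCD !polyC1 !polyC_natr; ring.
transitivity (('X : {poly R}) * (('X + l%:R) * lowering ('X + l%:R - 1) p) *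
    \prod_(1 <= i < l.+1) ('X - (p%:R + 1 - i%:R)%:P)); first by ring.
by rewrite -E; ring.
Qed.

(** For $S=(y)_{p+1}$ this is the inner sum over j. The conditional keeps truncated subtraction from
    reading the constant coefficient of [S] when $i<j$. *)
Lemma coef_subr1_exp (R : comNzRingType) (S : {poly R}) (r i : nat) :
  (S * (1 - 'X) ^+ r)`_i =
  \sum_(j < r.+1) (-1) ^+ j * 'C(r, j)%:R * (if (i < j)%N then 0 else S`_(i - j)).
Proof.
rewrite exprBn mulr_sumr coef_sum; apply: eq_bigr => j _.
rewrite expr1n mulr1 -mulr_natr -coefXnM.
have -> : S * ((-1) ^+ j * 'X^j * 'C(r, j)%:R) =
    ((-1) ^+ j * 'C(r, j)%:R)%:P * ('X^j * S).
  by rewrite polyCM polyC_natr rmorphXn rmorphN rmorph1 /=; ring.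
by rewrite coefCM.
Qed.

(** The parts weakly decrease while i increases, so these numbers strictly decrease; hence the poles
    are simple. *)
Lemma shifted_part_inj (la : seq int) : is_partition la ->
  {in index_iota 1 (size la).+1 &,
    injective (fun i : nat => 1 + (part la i)%:~R - i%:R : rat)}.
Proof.
move=> /andP[srt _].
have lt i j : (0 < i)%N -> (i < j)%N -> (j <= size la)%N ->
    1 + (part la j)%:~R - j%:R < 1 + (part la i)%:~R - i%:R :> rat.
  move=> i0 ij jl; have ltij : i%:R < j%:R :> rat by rewrite ltr_nat.
  suff : (part la j)%:~R <= (part la i)%:~R :> rat by lra.
  rewrite ler_int; apply: (sorted_leq_nth _ _ 0 srt).
  - by move=> a b c ab bc; apply: le_trans bc ab.
  - by move=> a; apply: lexx.
  - by rewrite inE; case: i i0 ij {ltij} => // i _ ij; apply: leq_trans (ltnW ij) jl.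
  - by rewrite inE; case: j ij jl {ltij}.
  - by rewrite -!subn1 leq_sub2r // ltnW.
move=> i j; rewrite !mem_index_iota !ltnS => /andP[i0 il] /andP[j0 jl] e.
by case: (ltngtP i j) => // ij; [have := lt i j i0 ij jl|have := lt j i j0 ij il];
  rewrite e ltxx.
Qed.

Theorem theorem3 (la : seq int) (p r : nat) :
  is_partition la -> (0 < p)%N ->
  \sum_(1 <= k < (size la).+1)
     dcoef la k p * ((part la k)%:~R - k%:R) ^+ r =
  (-1) ^+ r *
  \sum_(ij \in [set: nat * nat])
     (-1) ^+ ij.2 * 'C(r, ij.2)%:R *
     (stirling1 p.+1 (ij.1%:Z - ij.2%:Z))%:~R *
     ratfun_eval (ccoef la ij.1) p%:R.
Proof.
move=> Hla p0.
have x0 : p%:R != 0 :> rat by rewrite pnatr_eq0 -lt0n.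
set l := size la.
pose S : {poly rat} := lowering 'X p.+1.
have SM : S = map_poly (intr : int -> rat) (lowering 'X p.+1).
  rewrite /S /lowering rmorph_prod; apply: eq_bigr => i _ /=.
  by rewrite rmorphB /= map_polyX rmorph_nat.
have SE n : S`_n = (stirling1 p.+1 n%:Z)%:~R by rewrite SM coef_map.
have szS : size S = p.+2.
  by rewrite SM (size_map_inj_poly (@intr_inj rat)) ?size_lowering.
pose P := cnum p%:R la : {poly rat}; pose Q := cden p%:R la : {poly rat}.
(* This bounds both the indices i with nonzero weight and the size of $S(y)(1-y)^r$, whose degree is
   $r+p+1$. *)
pose n := (r + p.+1).+1.
rewrite (fsbigE [seq (i, j) | i <- iota 0 n, j <- iota 0 r.+1]) //; first last.
- move=> [i j] _; apply: contraNeq => nz.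
  have [||jr ir] := @stirling1_support p.+1 r i j.
  + by [].
  + apply: contraNneq nz => e0.
    by rewrite -[X in X * _]mulrA e0 mulr0 mul0r.
  by apply/allpairsP; exists (i, j); rewrite !mem_iota /= !add0n !ltnS.
- by rewrite allpairs_uniq ?iota_uniq // => -[a b] [c d].
rewrite (eq_bigl predT) => [|ij]; last by rewrite in_setT.
rewrite big_allpairs -{1}[n]subn0 -/(index_iota 0 n) big_mkord.
have -> : \sum_(i < n) \sum_(j <- iota 0 r.+1)
     (-1) ^+ j * 'C(r, j)%:R *
     (stirling1 p.+1 (i%:Z - j%:Z))%:~R *
     ratfun_eval (ccoef la i) p%:R =
   - ((S * (1 - 'X) ^+ r * P) %/ Q)`_0 / p%:R.
  rewrite (@coef0_divp_desc _ _ _ _ n); last first.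
    rewrite (leq_trans (size_polyMleq _ _)) // szS addSn /=.
    rewrite /n -addSn [leqRHS]addnC leq_add2l.
    rewrite (leq_trans (size_poly_exp_leq _ _)) // ltnS.
    by rewrite -opprB size_polyN size_XsubC mul1n.
  rewrite -sumrN mulr_suml; apply: eq_bigr => i _.
  rewrite coef_subr1_exp mulr_suml.
  rewrite -{1}[r.+1]subn0 -/(index_iota 0 r.+1) big_mkord -sumrN.
  rewrite mulr_suml; apply: eq_bigr => j _.
  rewrite ratfun_eval_ccoef //.
  have -> : (stirling1 p.+1 (i%:Z - j%:Z))%:~R =
      (if (i < j)%N then 0 else S`_(i - j)) :> rat.
    case: ltnP => ij; last by rewrite SE subzn.
    rewrite stirling1_eq0 // negb_and -ltNge; apply/orP; left.
    by rewrite ltrBlDr -PoszD ltz_nat add1n ltnS ltnW.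
  by rewrite [LHS]mulrA mulrN.
have -> : S * (1 - 'X) ^+ r * P =
  (\prod_(1 <= i < l.+1) ('X - (p%:R + 1 - i%:R)%:P)) *
  ('X * (lowering ('X + l%:R - 1) p * (1 - 'X) ^+ r *
    \prod_(1 <= i < l.+1) ('X - (p%:R + 1 + (part la i)%:~R - i%:R)%:P))).
  rewrite /P cnumE /content_num big_split /= -/l [X in _ * X]mulrC mulrACA loweringX_shift.
  by ring.
(* Only the poles $1+\lambda_k-k$ survive the cancellation, and the remaining factor y is the ['X]
   that [coef0_divp_XM] asks for. *)
rewrite /Q cdenE /content_den big_split /= divp_pmul2l -?/l; first last.
- by rewrite monic_neq0 // monic_prod_XsubC.
- by rewrite monic_neq0 // monic_prod_XsubC.
rewrite coef0_divp_XM ?iota_uniq //; last exact: shifted_part_inj.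
rewrite mulNr mulrN mulr_suml mulr_sumr -sumrN.
apply: eq_big_nat => k /andP[k1 kl].
set a := 1 + _ - _; have ka : k \in index_iota 1 l.+1 by rewrite mem_index_iota k1.
rewrite !hornerM horner_exp hornerD hornerN hornerC hornerX.
have -> : (lowering ('X + l%:R - 1) p).[a] =
    lowering ((part la k)%:~R + l%:R - k%:R) p.
  rewrite /lowering horner_prod; apply: eq_bigr => i _.
  rewrite !hornerD !hornerN hornerX hornerC -!polyC_natr !hornerC. by rewrite /a; ring.
rewrite horner_prod (bigD1_seq k) ?iota_uniq //= hornerXsubC.
rewrite /dcoef -/l prodf_div [X in _ = - (_ * (_ * (_ * X) / _ / _))](eq_bigr (fun i =>
    (part la k)%:~R - (part la i)%:~R + i%:R - k%:R - p%:R)) => [|i _]; last first.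
  by rewrite hornerXsubC /a; ring.
rewrite [X in _ = - (_ * (_ / X / _))](eq_bigr (fun i =>
    (part la k)%:~R - (part la i)%:~R + i%:R - k%:R)) => [|i _]; last first.
  by rewrite /a; ring.
(* The numerator factor with $i=k$, absent from [dcoef]; it cancels the $-1/p$ coming from
   [ccoef]. *)
have -> : a - (p%:R + 1 + (part la k)%:~R - k%:R) = - p%:R by rewrite /a; ring.
(* Here $\lambda_k-k=a-1$, whereas the expansion used powers of $1-y$; this accounts for the sign
   $(-1)^r$. *)
have -> : ((part la k)%:~R - k%:R) ^+ r = (-1) ^+ r * (1 - a) ^+ r :> rat.
  by rewrite -exprMn; congr (_ ^+ r); rewrite /a; ring.
set A := lowering _ _; set B := \prod_(_ <= _ < _ | _) _.
set C := \prod_(_ <= _ < _ | _) _.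
transitivity ((-1) ^+ r * (A * (1 - a) ^+ r * B) / C * (p%:R / p%:R)).
  by rewrite divff // mulr1; ring.
by ring.
Qed.
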